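(* Let $b=p_1^{r_1}\cdots p_s^{r_s}$ be a positive integer, where $p_1,\dots,p_s$ are distinct primes and $r_1,\dots,r_s\ge 1$, let $n$ be a positive integer, and let $C_b(n):=nb^n+1$. Suppose that there exist a prime $p_j$ dividing $b$ and an integer $K$ with $0\le K\le nr_j$ such that: (i) $\Phi_{p_j}\big((-n)^{b^n/p_j^{K+1}}\big)\equiv 0 \pmod{C_b(n)}$; (ii) $nr_j-K>\frac12\log_{p_j}(nb^n)=\frac12\log_{p_j}n+\frac n2\log_{p_j}b$. Then $C_b(n)$ is prime.
   Context: $\Phi_p(x)=1+x+\cdots+x^{p-1}$ denotes the $p$-th cyclotomic polynomial for a prime $p$. The integers $C_b(n) = nb^n+1$ are called Generalized Cullen Numbers. Condition (ii) forces $K<nr_j$, so that the exponent $b^n/p_j^{K+1}$ in (i) is an integer. *)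

(* Defs.v *)
From mathcomp Require Import all_boot all_order all_algebra all_field.
From mathcomp Require Import reals exp.

Set Implicit Arguments.
Unset Strict Implicit.
Unset Printing Implicit Defensive.

Import Order.TTheory GRing.Theory Num.Theory.
Local Open Scope ring_scope.

Definition gen_cullen (b n : nat) : nat := (n * b ^ n + 1)%N.

(* For a base d = 0 or d = 1 the value is the junk value 0, as [ln 0 = ln 1 = 0];
   here the base is always a prime. *)
Definition logb (R : realType) (d x : R) : R := ln x / ln d.

(* [Phi_p] is taken from the library, where ['Phi_m] is the m-th cyclotomic
   polynomial in [{poly int}]. *)
Lemma Cyclotomic_prime (p : nat) : prime p -> 'Phi_p = \sum_(i < p) 'X^i.
Proof.
move=> p_pr; have p_gt0 := prime_gt0 p_pr.
have Phi1 : 'Phi_1 = 'X - 1 :> {poly int}.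
  by have := @prod_Cyclotomic 1 isT; rewrite big_seq1 expr1.
have := prod_Cyclotomic p_gt0.
have dvdp : perm_eq (divisors p) [:: 1%N; p].
  apply: uniq_perm; rewrite ?divisors_uniq //=.
    by rewrite inE andbT; apply: contraTneq p_pr => <-.
  move=> d; rewrite -dvdn_divisors // !inE; apply/idP/idP.
    by have [_ dvdP] := primeP p_pr; move/dvdP.
  by case/orP => /eqP ->; rewrite ?dvd1n ?dvdnn.
rewrite (perm_big _ dvdp) big_cons big_seq1 /= Phi1 subrX1.
by apply: mulfI; rewrite -size_poly_gt0 size_XsubC.
Qed.

Lemma logb_cullen (R : realType) (p b n : nat) :
  (0 < b)%N -> (0 < n)%N ->
  2^-1 * logb (p%:R : R) (n * b ^ n)%:R =
  2^-1 * logb (p%:R : R) n%:R + n%:R / 2 * logb (p%:R : R) b%:R.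
Proof.
move=> b_gt0 n_gt0; rewrite /logb natrM natrX lnM ?posrE ?exprn_gt0 ?ltr0n //.
rewrite lnXn ?ltr0n // mulrDl mulrDr -(mulr_natl (ln _)).
by congr (_ + _); rewrite !mulrA [2^-1 * _]mulrC.
Qed.

(* Main.v *)
Require Import Defs.
From mathcomp Require Import all_boot all_order all_algebra all_field.
From mathcomp Require Import reals exp.

(** This is a Pocklington-style argument. Put [N = n * b ^ n + 1], [p = p j] and
    [t = n * r j - K - 1], and let [q] be a prime divisor of [N]. Since [p]
    divides [b], which is coprime to [N], it is invertible modulo [q]. The
    exponent [b ^ n / p ^ K.+1] has the form [u * p ^ t], so with [g = (- n) ^ u]
    the first hypothesis says that [g ^ (p ^ t)] is a root of ['Phi_p] in ['F_q].
    As [p] is nonzero in ['F_q], this root has order exactly [p], so [g] has order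
    exactly [p ^ t.+1], and [p ^ t.+1] divides [q - 1]
    ([cyclotomic_root_dvd_card]).

    The second hypothesis, once the logarithm is removed ([ltn_sqr_of_logb]),
    says that [n * b ^ n < (p ^ (n * r j - K)) ^ 2]. This forces [K < n * r j], so
    that [t] makes sense, and gives [N <= (q - 1) ^ 2 < q ^ 2] for every prime
    divisor [q] of [N]. Applied to the least one, this shows that [N] is
    prime. *)

Import Order.TTheory GRing.Theory Num.Theory.
Local Open Scope ring_scope.

(** The order of [g] divides [p ^ t.+1] but not [p ^ t], so it is [p ^ t.+1]. *)
Lemma pfactor_order_dvd (A : nzRingType) (g : A) (p t k : nat) :
  prime p -> g ^+ (p ^ t) != 1 -> g ^+ (p ^ t.+1) = 1 -> g ^+ k = 1 ->
  (p ^ t.+1 %| k)%N.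
Proof.
move=> p_pr gNt gSt gk.
have pt_gt0 : (0 < p ^ t.+1)%N by rewrite expn_gt0 prime_gt0.
have [d prim_d d_dvd] := prim_order_exists pt_gt0 gSt.
have /(dvdn_pfactor _ _ p_pr)[i le_i def_d] := d_dvd.
have := le_i; rewrite leq_eqVlt => /orP[/eqP def_i | lt_i].
  by rewrite -def_i -def_d (prim_order_dvd prim_d) gk.
case/negP: gNt; rewrite -(prim_order_dvd prim_d) def_d.
exact: dvdn_exp2l.
Qed.

(** Where [p] is nonzero, a root [x] of [1 + x + ... + x ^ p.-1] satisfies
    [x ^ p = 1] but is not [1], at which the sum takes the value [p]. *)
Lemma cyclotomic_root_dvd_card (F : finFieldType) (g : F) (p t : nat) :
  prime p -> p%:R != 0 :> F ->
  \sum_(i < p) (g ^+ (p ^ t)) ^+ i = 0 -> (p ^ t.+1 %| #|F|.-1)%N.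
Proof.
move=> p_pr p_neq0 root_g.
have gSt : g ^+ (p ^ t.+1) = 1.
  apply/eqP; rewrite expnSr exprM -subr_eq0 subrX1 root_g.
  by rewrite mulr0.
have gNt : g ^+ (p ^ t) != 1.
  apply: contraNneq p_neq0 => g1; move: root_g; rewrite g1.
  under eq_bigr do rewrite expr1n.
  by rewrite sumr_const card_ord => ->.
have g_neq0 : g != 0.
  have := oner_neq0 F; apply: contraNneq => g0.
  by rewrite -gSt g0 expr0n expn_eq0 -leqn0 leqNgt prime_gt0.
apply: pfactor_order_dvd p_pr gNt gSt _.
apply: (mulfI g_neq0); rewrite mulr1 -exprS prednK ?expf_card //.
by apply/card_gt0P; exists g.
Qed.

Lemma intr_Fp_eq0 (q : nat) (z : int) :
  prime q -> (q%:Z %| z)%Z -> z%:~R = 0 :> 'F_q.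
Proof.
move=> q_pr /dvdzP[w ->].
by rewrite rmorphM /= -pmulrn pchar_Fp_0 ?mulr0.
Qed.

Lemma Cyclotomic_prime_root_dvd (p q t : nat) (a : int) :
  prime p -> prime q -> ~~ (q %| p)%N ->
  (q%:Z %| ('Phi_p).[a ^+ (p ^ t)%N])%Z -> (p ^ t.+1 %| q.-1)%N.
Proof.
move=> p_pr q_pr qNp /(intr_Fp_eq0 _ _ q_pr).
rewrite Cyclotomic_prime // horner_sum rmorph_sum /=.
under eq_bigr do rewrite hornerXn !rmorphXn /=.
move=> /cyclotomic_root_dvd_card; rewrite card_Fp //; apply=> //.
by rewrite -(dvdn_pcharf (pchar_Fp q_pr)).
Qed.

Lemma ltn_sqr_of_logb (R : realType) (p N e : nat) :
  (1 < p)%N -> (0 < N)%N ->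
  2^-1 * logb p%:R N%:R < e%:R :> R -> (N < (p ^ e) ^ 2)%N.
Proof.
move=> p_gt1 N_gt0.
have p_gt0 : (0 < p)%N by apply: ltnW.
have lnp_gt0 : 0 < ln (p%:R : R) by rewrite ln_gt0 // ltr1n.
rewrite mulrC ltr_pdivrMr ?ltr0n // /logb ltr_pdivrMr // => ltN.
rewrite -(ltr_nat R) -ltr_ln ?posrE ?ltr0n ?expn_gt0 ?p_gt0 //.
rewrite -expnM natrX lnXn ?ltr0n //.
by rewrite -[ltRHS]mulr_natl natrM.
Qed.

Lemma prime_dvd_gen_cullen_ndvd_base (b n q : nat) :
  (0 < n)%N -> prime q -> (q %| gen_cullen b n)%N -> ~~ (q %| b)%N.
Proof.
move=> n_gt0 q_pr q_dvd; apply/negP => q_b.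
move: q_dvd; rewrite /gen_cullen dvdn_addr; last first.
  by apply/dvdn_mull/(dvdn_trans q_b)/dvdn_exp.
by rewrite dvdn1 => /eqP q1; rewrite q1 in q_pr.
Qed.

Theorem theorem2 (R : realType) (s : nat) (p r : 'I_s -> nat) (b n : nat)
    (p_prime : forall i, prime (p i))
    (p_distinct : injective p)
    (r_ge1 : forall i, (1 <= r i)%N)
    (b_def : b = (\prod_(i < s) p i ^ r i)%N)
    (n_gt0 : (0 < n)%N)
    (cullen_test : exists (j : 'I_s) (K : nat),
      [/\ (K <= n * r j)%N,
          (('Phi_(p j)).[(- n%:Z) ^+ (b ^ n %/ p j ^ K.+1)%N] = 0
             %[mod (gen_cullen b n)%:Z])%Z
        & (n * r j)%:R - K%:R > 2^-1 * logb (p j)%:R (n * b ^ n)%:R :> R]) :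
  prime (gen_cullen b n).
Proof.
have [j [K [leK root_n lt_log]]] := cullen_test.
have p_pr := p_prime j.
have b_gt0 : (0 < b)%N.
  by rewrite b_def prodn_gt0 // => i; rewrite expn_gt0 prime_gt0.
have pr_b : (p j ^ r j %| b)%N by rewrite b_def (bigD1 j) //= dvdn_mulr.
have p_b : (p j %| b)%N by apply: dvdn_trans pr_b; rewrite dvdn_exp.
have nbn_gt0 : (0 < n * b ^ n)%N by rewrite muln_gt0 n_gt0 expn_gt0 b_gt0.
move: lt_log; rewrite -natrB // => /(ltn_sqr_of_logb _ _ _ _ (prime_gt1 p_pr) nbn_gt0).
case def_t: (n * r j - K)%N => [|t] lt_sq.
  by move: lt_sq; rewrite expn0 exp1n ltnNge nbn_gt0.
have def_e : (b ^ n %/ p j ^ K.+1 = b ^ n %/ p j ^ (n * r j) * p j ^ t)%N.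
  have -> : (n * r j = t + K.+1)%N by rewrite addnS -addSn -def_t subnK.
  have /dvdnP[u ->] : (p j ^ (t + K.+1) %| b ^ n)%N.
    by rewrite addnS -addSn -def_t subnK // mulnC expnM dvdn_exp2r.
  have pk_gt0 k : (0 < p j ^ k)%N by rewrite expn_gt0 prime_gt0.
  by rewrite mulnK // expnD mulnA mulnK.
set N := gen_cullen b n in root_n *.
have N_gt1 : (1 < N)%N by rewrite /N /gen_cullen addn1 ltnS.
have q_pr := pdiv_prime N_gt1; have q_dvd := pdiv_dvd N.
apply: ltn_pdiv2_prime; first exact: ltnW.
set q := pdiv N in q_pr q_dvd *.
have qNb : ~~ (q %| b)%N by apply: prime_dvd_gen_cullen_ndvd_base q_dvd.
have pt_dvd : (p j ^ t.+1 %| q.-1)%N.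
  apply: (Cyclotomic_prime_root_dvd _ _ _ ((- n%:Z) ^+ (b ^ n %/ p j ^ (n * r j)))) => //.
    by apply: contra qNb => q_p; apply: dvdn_trans p_b.
  rewrite -exprM -def_e; apply: (@dvdz_trans N%:Z) => //.
  by apply/dvdz_mod0P; rewrite root_n mod0z.
have q_gt1 := prime_gt1 q_pr.
have lt_pq : (p j ^ t.+1 < q)%N.
  by rewrite -[q]prednK ?prime_gt0 // ltnS dvdn_leq // -ltnS prednK ?prime_gt0.
rewrite /N /gen_cullen addn1; apply: leq_ltn_trans lt_sq _.
by rewrite ltn_exp2r.
Qed.
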